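(* Let $X$ be a complex Banach space, let $T \in L(X)$ and let $\Psi=(\Psi_1,\Psi_2)$ be a spectral partitioning function for $T$. If $\Phi=(\Phi_1,\Phi_2)$ is a spectral valued function such that $\Psi \leq \Phi$, then $\Phi$ is a spectral a-partitioning function for $T$ if and only if $\Psi_1(T) \setminus \Phi_1(T) = (\Phi_2(T) \setminus \Psi_2(T)) \bigsqcup (\sigma(T)\setminus \sigma_a(T))$.
   Context: $L(X)$ is the Banach algebra of bounded linear operators on $X$; $\sigma(T)$ is the spectrum and $\sigma_a(T)$ the approximate point spectrum of $T$; $\mathcal{P}(\mathbb{C})$ is the set of all subsets of $\mathbb{C}$. The symbol $\bigsqcup$ denotes disjoint union: $A = B \bigsqcup C$ means $A = B\cup C$ and $B\cap C=\emptyset$. A spectral valued function is a function $\Phi=(\Phi_1,\Phi_2): L(X)\to \mathcal{P}(\mathbb{C})\times\mathcal{P}(\mathbb{C})$ such that for every $S\in L(X)$, $\Phi_1(S)\subset\sigma(S)$ and $\Phi_2(S)\subset\sigma(S)$. A spectral valued function $\Phi$ is a spectral partitioning function for $T\in L(X)$ if $\sigma(T)=\Phi_1(T)\bigsqcup\Phi_2(T)$, and a spectral a-partitioning function for $T$ if $\sigma_a(T)=\Phi_1(T)\bigsqcup\Phi_2(T)$. For spectral valued functions $\Psi,\Phi$, write $\Psi\leq\Phi$ if for all $S\in L(X)$, $\Phi_1(S)\subset\Psi_1(S)$ and $\Psi_2(S)\subset\Phi_2(S)$. *)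

(* Defs.v *)
(* The complex field is [R[i]] for [R : realType], and a
   complex Banach space is a [completeNormedModType R[i]]; norms are real
   elements of [R[i]]. *)
From HB Require Import structures.
From mathcomp Require Import all_boot all_order all_algebra.
From mathcomp Require Import complex.
From mathcomp Require Import boolp classical_sets reals topology normedtype.
From mathcomp Require Import sequences.

Set Implicit Arguments.
Unset Strict Implicit.
Unset Printing Implicit Defensive.

Import Order.TTheory GRing.Theory Num.Theory.
Import numFieldNormedType.Exports.

Local Open Scope classical_set_scope.
Local Open Scope ring_scope.

Record bounded_operator (R : realType) (X : completeNormedModType R[i]) :=
  BoundedOperator {
    bounded_operator_fun :> {linear X -> X} ;
    bounded_operatorP :
      exists M : R[i], forall x : X, `|bounded_operator_fun x| <= M * `|x|
  }.

Notation "''L' ( X )" := (bounded_operator X)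
  (at level 0, format "''L' ( X )") : type_scope.

Section Spectrum.
Variables (R : realType) (X : completeNormedModType R[i]).
Implicit Types (T S : 'L(X)) (l : R[i]).

Definition shift_operator T l : X -> X := fun x => T x - l *: x.

(* The inverse is required to be bounded: invertibility is in the algebra
   [L(X)], not merely bijectivity. *)
Definition invertible_in_L (f : X -> X) : Prop :=
  exists S : 'L(X), cancel f S /\ cancel S f.

Definition spectrum T : set R[i] :=
  [set l | ~ invertible_in_L (shift_operator T l)].

Definition approximate_point_spectrum T : set R[i] :=
  [set l | exists u : nat -> X,
     (forall n, `|u n| = 1) /\
     (fun n => shift_operator T l (u n)) @ \oo --> (0 : X)].

Definition disjoint_union (A B C : set R[i]) : Prop :=
  A = B `|` C /\ B `&` C = set0.

Implicit Types Phi Psi : 'L(X) -> set R[i] * set R[i].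

Definition spectral_valued Phi : Prop :=
  forall S, (Phi S).1 `<=` spectrum S /\ (Phi S).2 `<=` spectrum S.

Definition spectral_partitioning T Phi : Prop :=
  spectral_valued Phi /\ disjoint_union (spectrum T) (Phi T).1 (Phi T).2.

Definition spectral_a_partitioning T Phi : Prop :=
  spectral_valued Phi /\
  disjoint_union (approximate_point_spectrum T) (Phi T).1 (Phi T).2.

(* The first components are compared in the reverse direction. *)
Definition spectral_le Psi Phi : Prop :=
  forall S, (Phi S).1 `<=` (Psi S).1 /\ (Psi S).2 `<=` (Phi S).2.

End Spectrum.

(* Main.v *)
Require Import Defs.
From HB Require Import structures.
From mathcomp Require Import all_boot all_order all_algebra.
From mathcomp Require Import complex.
From mathcomp Require Import boolp classical_sets reals topology normedtype.
From mathcomp Require Import sequences.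

Set Implicit Arguments.
Unset Strict Implicit.
Unset Printing Implicit Defensive.

Import Order.TTheory GRing.Theory Num.Theory.
Import numFieldNormedType.Exports.

Local Open Scope classical_set_scope.
Local Open Scope ring_scope.

(** The only analytic input is that the approximate point spectrum lies in the spectrum; the rest is
    pointwise set algebra inside the spectrum. There [Psi] splits every point into exactly one of
    two classes, and passing to [Phi] shrinks the first class and enlarges the second. A point
    dropped from the first class either migrates to the second or is left uncovered. The stated
    identity says that the uncovered points are exactly those outside the approximate point
    spectrum, and that no point is covered twice. *)

(** A bounded inverse [S] of [T - l] would give 1 = |S (T - l) u_n| <= M |(T - l) u_n|, which is
    impossible once the right side tends to 0. *)
Lemma approximate_point_spectrum_sub (R : realType)
    (X : completeNormedModType R[i]) (T : 'L(X)) :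
  approximate_point_spectrum T `<=` spectrum T.
Proof.
move=> l [u [u1 Tu0]] [S [STK _]].
have [M SM] := bounded_operatorP S.
(* The added 1 keeps the threshold invertible even if [M] is 0. *)
have M1 : 0 < `|M| + 1 by rewrite ltr_wpDl.
have /cvgr0_norm_lt /(_ (`|M| + 1)^-1) := Tu0.
rewrite invr_gt0 => /(_ M1) [N _ /(_ N (leqnn N))] /= TuN.
have := SM (shift_operator T l (u N)); rewrite STK u1 => Mle.
(* [M] is a complex number of unknown sign, but the product is at least 1, hence real and
   nonnegative, so [M] may be replaced by its modulus there. *)
have /ger0_norm := le_trans ler01 Mle; rewrite normrM normr_id => normM.
suff : 1 < (1 : R[i]) by rewrite ltxx.
apply: le_lt_trans Mle _; rewrite -normM.
apply: (@le_lt_trans _ _ ((`|M| + 1) * `|shift_operator T l (u N)|)).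
  by rewrite ler_wpM2r // lerDl.
by rewrite -[ltRHS](divff (lt0r_neq0 M1)) ltr_pM2l.
Qed.

Theorem corollary4p4 (R : realType) (X : completeNormedModType R[i])
    (T : 'L(X)) (Psi Phi : 'L(X) -> set R[i] * set R[i])
    (hPsi : spectral_partitioning T Psi)
    (hPhi : spectral_valued Phi)
    (hle : spectral_le Psi Phi) :
  spectral_a_partitioning T Phi <->
  disjoint_union ((Psi T).1 `\` (Phi T).1)
    ((Phi T).2 `\` (Psi T).2)
    (spectrum T `\` approximate_point_spectrum T).
Proof.
have [_ [sigmaE Psi0]] := hPsi.
have [Phi1_sub Phi2_sub] := hPhi T.
have [Phi1_Psi1 Psi2_Phi2] := hle T.
have Psi_disj x : (Psi T).1 x -> ~ (Psi T).2 x.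
  by move=> x1 x2; rewrite -[False]/(set0 x) -Psi0.
have Psi_cover x : spectrum T x -> (Psi T).1 x \/ (Psi T).2 x.
  by rewrite sigmaE.
have Psi1_sub x : (Psi T).1 x -> spectrum T x by rewrite sigmaE; left.
have sub_sigma := @approximate_point_spectrum_sub _ _ T.
split=> [[_ [aE Phi0]]|[DE D0]].
  have Phi_disj x : (Phi T).1 x -> ~ (Phi T).2 x.
    by move=> x1 x2; rewrite -[False]/(set0 x) -Phi0.
  (* From here a point is outside the approximate point spectrum exactly when neither component of
     [Phi T] contains it. *)
  rewrite aE; split; apply/seteqP; split=> x //=.
  - move=> [x1 nx1]; have [x2|nx2] := pselect ((Phi T).2 x).
      by left; split=> //; exact: Psi_disj.
    by right; split; [exact: Psi1_sub|case].
  - move=> [[x2 nx2]|[xs nx]].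
      split; first by case: (Psi_cover _ (Phi2_sub _ x2)).
      by move=> x1; exact: (Phi_disj x).
    split; last by move=> x1; apply: nx; left.
    by case: (Psi_cover _ xs) => // /Psi2_Phi2 x2; case: nx; right.
  - by move=> [[x2 _] [_ []]]; right.
have D_disj x : (Phi T).2 x -> ~ (Psi T).2 x ->
    spectrum T x -> approximate_point_spectrum T x.
  move=> x2 nx2 xs; apply: contrapT => nx.
  by rewrite -[False]/(set0 x) -D0.
split=> //; split; apply/seteqP; split=> x //=.
- move=> xa; case: (Psi_cover _ (sub_sigma _ xa)) => [x1|/Psi2_Phi2]; last by right.
  have [|nx1] := pselect ((Phi T).1 x); first by left.
  have : ((Psi T).1 `\` (Phi T).1) x by [].
  by rewrite DE => -[[x2 _]|[]//]; right.
- have nD : spectrum T x -> ~ approximate_point_spectrum T x ->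
      ((Psi T).1 `\` (Phi T).1) x by move=> *; rewrite DE; right.
  (* If [x] were not an approximate eigenvalue, it would have been dropped from the first class:
     absurd for [x1]. For [x2] it would also have migrated, against the disjointness [D0]. *)
  move=> [x1|x2]; apply: contrapT => nx.
    by have [] := nD (Phi1_sub _ x1) nx.
  have [/Psi_disj x1 _] := nD (Phi2_sub _ x2) nx.
  by apply: nx; apply: D_disj => //; exact: Phi2_sub.
(* A point covered twice would count as migrated, hence as dropped from the first class, which still
   contains it. *)
- move=> [x1 x2]; have : ((Psi T).1 `\` (Phi T).1) x.
    by rewrite DE; left; split=> //; exact/Psi_disj/Phi1_Psi1.
  by case.
Qed.
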